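(* There is at most one viscosity solution to the Dirichlet problem $$F(w,u,u',u'')=0\ \text{ in }(b,w_s),\qquad u(b)=1,\quad u(w_s)=0,$$ that is bounded, non-negative, and continuous at the boundary.
   Context: Constants: $r>0$, $\mu>r$, $\sigma>0$, $c>0$, $\lambda>0$, $\varepsilon>0$, $b\in\mathbb{R}$ with $b<w_s:=c/r$. $F$ is the $(-\infty,+\infty]$-valued function $$F(w,u,p,A)=\lambda u-\inf_{\pi\in\mathbb R}\left\{\frac12\sigma^2(\varepsilon p^2+A)\pi^2+(\mu-r)p\,\pi+(rw-c)p\right\}.$$ An upper semicontinuous (u.s.c.) function $u$ is a viscosity subsolution of $F=0$ in $(b,w_s)$ if $F(w_0,u(w_0),\varphi'(w_0),\varphi''(w_0))\le0$ whenever $\varphi\in C^2(b,w_s)$ and $u-\varphi$ has a local maximum at $w_0\in(b,w_s)$. A lower semicontinuous (l.s.c.) function $u$ is a viscosity supersolution if $F(w_0,u(w_0),\varphi'(w_0),\varphi''(w_0))\ge0$ whenever $\varphi\in C^2(b,w_s)$ and $u-\varphi$ has a local minimum at $w_0\in(b,w_s)$ (the inequality holds trivially if $F=+\infty$). A viscosity solution is a function on $[b,w_s]$ whose u.s.c. envelope is a subsolution and whose l.s.c. envelope is a supersolution. ''Continuous at the boundary'' means continuous at $b$ and at $w_s$. *)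

(* Defs.v *)
From HB Require Import structures.
From mathcomp Require Import all_boot all_order all_algebra.
From mathcomp Require Import all_classical all_reals all_analysis.
Import Order.TTheory GRing.Theory Num.Theory.
Import numFieldNormedType.Exports.

Set Implicit Arguments.
Unset Strict Implicit.
Unset Printing Implicit Defensive.

Local Open Scope classical_set_scope.
Local Open Scope ring_scope.

(* The infimum is [-oo] when the quadratic in [q] is unbounded below, in which
   case [hjbF] is [+oo]; it is never [-oo]. *)
Definition hjbF (R : realType) (r mu sigma c lambda eps : R)
    (w u p A : R) : \bar R :=
  ((lambda * u)%:E
   - ereal_inf [set (2^-1 * sigma ^+ 2 * (eps * p ^+ 2 + A) * q ^+ 2
                     + (mu - r) * p * q + (r * w - c) * p)%:E
               | q in [set: R]])%E.

(* Semicontinuity relative to [D]: points outside [D] are isolated in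
   [subspace D], hence impose no condition. *)
Definition lsc_on (R : realType) (D : set R) (u : R -> R) : Prop :=
  lower_semicontinuous (fun x : subspace D => (u x)%:E).

Definition usc_on (R : realType) (D : set R) (u : R -> R) : Prop :=
  lsc_on D (fun x => - u x).

(* The filter [within D (nbhs x)] contains the point [x] itself, so for [x] in
   [D] these are the least u.s.c. majorant and the greatest l.s.c. minorant
   of [u] on [D]. *)
Definition usc_envelope (R : realType) (D : set R) (u : R -> R) (x : R) :
    \bar R :=
  limf_esup (fun y => (u y)%:E) (within D (nbhs x)).

Definition lsc_envelope (R : realType) (D : set R) (u : R -> R) (x : R) :
    \bar R :=
  limf_einf (fun y => (u y)%:E) (within D (nbhs x)).

Definition C2_on (R : realType) (a b : R) (phi : R -> R) : Prop :=
  [/\ {in `]a, b[, forall x, derivable phi x 1},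
      {in `]a, b[, forall x, derivable (derive1 phi) x 1} &
      {in `]a, b[, continuous (derive1n 2 phi)}].

Definition local_max (R : realType) (f : R -> R) (x : R) : Prop :=
  \forall y \near x, f y <= f x.

Definition local_min (R : realType) (f : R -> R) (x : R) : Prop :=
  \forall y \near x, f x <= f y.

Definition viscosity_subsolution (R : realType)
    (F : R -> R -> R -> R -> \bar R) (a b : R) (u : R -> R) : Prop :=
  usc_on `]a, b[ u /\
  forall (phi : R -> R) (w : R), C2_on a b phi -> w \in `]a, b[ ->
    local_max (fun x => u x - phi x) w ->
    (F w (u w) (derive1 phi w) (derive1n 2 phi w) <= 0)%E.

Definition viscosity_supersolution (R : realType)
    (F : R -> R -> R -> R -> \bar R) (a b : R) (u : R -> R) : Prop :=
  lsc_on `]a, b[ u /\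
  forall (phi : R -> R) (w : R), C2_on a b phi -> w \in `]a, b[ ->
    local_min (fun x => u x - phi x) w ->
    (0 <= F w (u w) (derive1 phi w) (derive1n 2 phi w))%E.

(* Only the values of [u] on [[a, b]] matter.  The envelopes are required to be
   finite, so that [fine] loses nothing; this is automatic for bounded [u]. *)
Definition viscosity_solution (R : realType)
    (F : R -> R -> R -> R -> \bar R) (a b : R) (u : R -> R) : Prop :=
  [/\ {in `[a, b], forall x, usc_envelope `[a, b] u x \is a fin_num},
      {in `[a, b], forall x, lsc_envelope `[a, b] u x \is a fin_num},
      viscosity_subsolution F a b (fun x => fine (usc_envelope `[a, b] u x)) &
      viscosity_supersolution F a b (fun x => fine (lsc_envelope `[a, b] u x))].

Definition continuous_at_within (R : realType) (D : set R) (u : R -> R)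
    (x : R) : Prop :=
  u @ within D (nbhs x) --> u x.

Definition admissible_solution (R : realType)
    (F : R -> R -> R -> R -> \bar R) (a b ua ub : R) (u : R -> R) : Prop :=
  [/\ viscosity_solution F a b u, u a = ua & u b = ub] /\
  [/\ [bounded u x | x in `[a, b]],
      {in `[a, b], forall x, 0 <= u x},
      continuous_at_within `[a, b] u a &
      continuous_at_within `[a, b] u b].

(* Main.v *)
Require Import Defs.
From mathcomp Require Import all_boot all_order all_algebra.
From mathcomp Require Import all_classical all_reals all_analysis.
From mathcomp Require Import ring lra.
Import Order.TTheory GRing.Theory Num.Theory.
Import numFieldNormedType.Exports.
Local Open Scope classical_set_scope.
Local Open Scope ring_scope.

(* Because [F] is [+oo] where [eps p^2 + A < 0], a subsolution [U] has
   [exp (2 eps U)] convex; so [U] is locally Lipschitz and semiconvex.  At an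
   interior maximum [w0] of [U - V] with [V w0 < U w0], semiconvexity alone
   replaces the usual doubling of variables: it yields a parabola below [U] at
   [w0] whose coefficients [p], [A] satisfy [inf_q hjbQ >= k] for a number [k]
   strictly between [lambda V w0] and [lambda U w0].  The same parabola,
   shifted, touches the supersolution [V] from below at [w0], which forces
   [k <= lambda V w0]. *)

(** The infimum over [q] is only upper semicontinuous in [(w, p, A)] and drops to [-oo] where
    [eps p^2 + A < 0], so the continuity estimates behind doubling are not at hand. An upper bound
    on it, however, is witnessed by one control, and at a fixed control everything is polynomial;
    the strict inequality [k < lambda U w0] makes such a bound persist near [w0]. The exponential
    comes from [(exp (eps U))'' = eps exp (eps U) (U'' + eps U'^2)]. The coefficient [A] solves [(r
    w0 - c) p - ((mu - r) p)^2 / (2 sigma^2 (eps p^2 + A)) = k], which requires [(r w0 - c) p > k];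
    the control [q = 0] supplies this. Since [k >= 0] and [r w0 - c < 0], it also forces [p < 0]. *)

Definition usc_within {R : realType} (D : set R) (f : R -> R) : Prop :=
  forall x, D x -> forall k, f x < k -> \forall y \near x, D y -> f y < k.

(** Exact parabolas, without an o-remainder, since each is directly a smooth test function. A
    parabola below [V] is encoded as one above [- V], with [- p] and [- A]. *)
Definition superjet {R : realType} (f : R -> R) (w p A : R) : Prop :=
  \forall y \near w, f y <= f w + p * (y - w) + A / 2 * (y - w) ^+ 2.

(** Convexity on the open interval, cleared of denominators so that it is linear in the values of
    [f]. *)
Definition three_point_convex {R : realType} (x z : R) (f : R -> R) : Prop :=
  forall u v w, x < u -> u < v -> v < w -> w < z ->
  (w - u) * f v <= (w - v) * f u + (v - u) * f w.

(** * Neighbourhoods and upper semicontinuity on the real line *)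

Lemma near_ball {R : realType} (x : R) (P : R -> Prop) :
  (\forall y \near x, P y) -> exists2 d, 0 < d & forall y, `|y - x| < d -> P y.
Proof.
move=> /nbhs_ballP[d /= d0 H]; exists d => // y yx; apply: H.
by rewrite /ball /= distrC.
Qed.

Lemma ball_near {R : realType} (x d : R) (P : R -> Prop) :
  0 < d -> (forall y, `|y - x| < d -> P y) -> \forall y \near x, P y.
Proof.
move=> d0 H; apply/nbhs_ballP; exists d => //= y; rewrite /ball /= distrC.
exact: H.
Qed.

(** Without a maximum, each [x] has a neighbourhood where [f] stays below some [f y], hence below
    [f i] for all [i] far enough in the filter of superlevel sets. By compactness one such [i]
    serves the whole segment, itself included. *)
Lemma usc_within_max {R : realType} (a e : R) (f : R -> R) : a <= e ->
  usc_within `[a, e] f ->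
  exists2 c, a <= c <= e & forall x, a <= x <= e -> f x <= f c.
Proof.
move=> ae uf; apply: contrapT => nmax.
have up x : a <= x <= e -> exists2 y, a <= y <= e & f x < f y.
  move=> xI; apply: contrapT => ny; apply: nmax; exists x => // y yI.
  by rewrite leNgt; apply/negP => fxy; apply: ny; exists y.
pose F : set_system R := [set A | exists2 x, a <= x <= e &
  forall y, a <= y <= e -> f x <= f y -> A y].
have FF : Filter F.
  split.
  - by exists a => //; rewrite lexx.
  - move=> A B [x xI xA] [y yI yB].
    have [fxy|/ltW fyx] := leP (f x) (f y).
      exists y => // z zI yz; split; last exact: yB.
      exact/xA/(le_trans fxy).
    exists x => // z zI xz; split; first exact: xA.
    exact/yB/(le_trans fyx).
  - by move=> A B AB [x xI xA]; exists x => // y yI /(xA _ yI)/AB.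
have /compact_near_coveringP/near_covering_withinP cpt := @segment_compact R a e.
have : \forall i \near F, `[a, e]%classic `<=` (fun x => f x < f i).
  apply: cpt => x; rewrite /= in_itv /= => xI.
  have [y yI fxy] := up _ xI.
  exists ([set z | `[a, e]%classic z -> f z < f y], [set i | f y <= f i]) => /=.
    split; last by exists y.
    by apply: uf => //=; rewrite in_itv.
  by move=> [z i] /= [zy yi] zI; apply: lt_le_trans (zy zI) yi.
move=> [x xI /(_ _ xI (lexx _))/(_ x)].
by rewrite /= in_itv /= ltxx => /(_ xI).
Qed.

Lemma continuous_near_lt {R : realType} {T : topologicalType} (f g : T -> R)
    (x : T) : {for x, continuous f} -> {for x, continuous g} -> f x < g x ->
  \forall y \near x, f y < g y.
Proof.
move=> cf cg fg.
have ch : {for x, continuous (fun y => g y - f y)} by apply: cvgB.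
have h0 : 0 < g x - f x by rewrite subr_gt0.
have : \forall y \near x, 0 < g y - f y by exact: cvgr_gt ch _ h0.
by apply: filterS => y; rewrite subr_gt0.
Qed.

Lemma usc_withinD {R : realType} (D : set R) (f g : R -> R) :
  usc_within D f -> usc_within D g -> usc_within D (fun x => f x + g x).
Proof.
move=> uf ug x xD k fgk.
pose d := (k - (f x + g x)) / 2.
have d0 : 0 < d by rewrite /d; lra.
have := uf x xD (f x + d); rewrite ltrDl => /(_ d0) H1.
have := ug x xD (g x + d); rewrite ltrDl => /(_ d0) H2.
apply: filterS2 H1 H2 => y /[swap] + + yD => /(_ yD) + /(_ yD).
by rewrite /d; lra.
Qed.

Lemma continuous_usc {R : realType} (D : set R) (f : R -> R) :
  (forall x, D x -> {for x, continuous f}) -> usc_within D f.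
Proof.
move=> cf x xD k fk.
have : \forall y \near x, f y < k by exact: cvgr_lt (cf x xD) _ fk.
exact: filterS.
Qed.

Lemma usc_within_sub {R : realType} (D E : set R) (f : R -> R) :
  D `<=` E -> usc_within E f -> usc_within D f.
Proof.
move=> DE uf x xD k fk; have := uf x (DE _ xD) k fk.
by apply: filterS => y H /DE.
Qed.

Lemma usc_within_expR {R : realType} (D : set R) (f : R -> R) (K : R) : 0 < K ->
  usc_within D f -> usc_within D (fun x => expR (K * f x)).
Proof.
move=> K0 uf x xD k ek.
have k0 : 0 < k by apply: lt_trans ek; exact: expR_gt0.
have eq y : (expR (K * f y) < k) = (f y < ln k / K).
  by rewrite ltr_pdivlMr // (mulrC (f y)) -[in RHS]ltr_expR lnK ?posrE.
rewrite eq in ek; have := uf x xD _ ek.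
by apply: filterS => y H /H; rewrite eq.
Qed.

Lemma near_between {R : realType} (u w c : R) : u < c -> c < w ->
  \forall y \near c, u < y < w.
Proof.
move=> uc cw.
have H1 : \forall y \near c, u < y by exact: lt_nbhsr.
have H2 : \forall y \near c, y < w by exact: lt_nbhsl.
by apply: filterS2 H1 H2 => y -> ->.
Qed.

Lemma continuous_quadratic {R : realType} (k p A c : R) :
  continuous (fun t : R => k + p * (t - c) + A * (t - c) ^+ 2).
Proof.
move=> x; apply: cvgD; [apply: cvgD; first exact: cvg_cst|].
  by apply: cvgM; [exact: cvg_cst|apply: cvgB; [exact: cvg_id|exact: cvg_cst]].
apply: cvgM; [exact: cvg_cst|]; rewrite expr2; apply: cvgM;
  by apply: cvgB; [exact: cvg_id|exact: cvg_cst].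
Qed.

(* If [f] exceeds a chord, push a slightly strictly concave parabola down onto
   its graph: at the contact point the parabola is a superjet with [A < 0]. *)
Lemma three_point_of_superjets {R : realType} (x z : R) (f : R -> R) :
  usc_within `]x, z[ f ->
  (forall w p A, x < w < z -> superjet f w p A -> 0 <= A) ->
  three_point_convex x z f.
Proof.
move=> uf jf u v w xu uv vw wz; rewrite leNgt; apply/negP => H.
pose s := (f w - f u) / (w - u).
have wu0 : w - u != 0 by rewrite subr_eq0; apply/eqP; lra.
have sE : s * (w - u) = f w - f u by rewrite /s divfK.
pose D := (v - u) * (w - v).
have D0 : 0 < D by rewrite /D mulr_gt0 // subr_gt0.
pose m := f v - (f u + s * (v - u)).
have m0 : 0 < m.
  have : 0 < (w - u) * m.
    have -> : (w - u) * m =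
        (w - u) * f v - (w - u) * f u - (s * (w - u)) * (v - u).
      by rewrite /m; ring.
    by rewrite sE; lra.
  by rewrite pmulr_rgt0 // subr_gt0; lra.
(* The bump [d * (t - u) * (w - t)] added to the chord removes half of the excess [m] at [v] and
   nothing at [u] and [w], so the maximum of [f - psi] is positive and interior. *)
pose d := m / 2 / D.
have d0 : 0 < d by rewrite /d !divr_gt0.
pose psi (t : R) := f u + (s + d * (w - u)) * (t - u) + (- d) * (t - u) ^+ 2.
have ug : usc_within `[u, w] (fun t => f t + - psi t).
  apply: usc_withinD.
    by apply: usc_within_sub uf => t /=; rewrite !in_itv /=; lra.
  by apply: continuous_usc => t _; apply: cvgN; exact: continuous_quadratic.
have [] := usc_within_max u w _ _ ug; first by lra.
move=> c /andP[uc cw] cmax.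
have gv : f v - psi v = m / 2.
  have dD : d * D = m / 2 by rewrite /d divfK // gt_eqF.
  have -> : f v - psi v = m - d * D by rewrite /m /psi /D; ring.
  by rewrite dD; field.
have gu : f u - psi u = 0 by rewrite /psi; ring.
have gw : f w - psi w = 0.
  transitivity (f w - f u - s * (w - u)); first by rewrite /psi; ring.
  by rewrite sE subrr.
have gc : 0 < f c - psi c.
  by apply: lt_le_trans (cmax v _); [rewrite gv divr_gt0|lra].
have {}uc : u < c.
  by rewrite lt_neqAle uc andbT; apply/eqP => uc'; move: gc; rewrite -uc' gu ltxx.
have {}cw : c < w.
  by rewrite lt_neqAle cw andbT; apply/eqP => uc'; move: gc; rewrite uc' gw ltxx.
have := jf c (s + d * (u + w - 2 * c)) (- (2 * d)).
have -> : x < c < z by lra.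
suff: superjet f c (s + d * (u + w - 2 * c)) (- (2 * d)).
  by move=> S /(_ isT S); lra.
have := near_between _ _ _ uc cw; apply: filterS => y /andP[uy yw].
have : f y - psi y <= f c - psi c by apply: cmax; lra.
rewrite /psi => Hy; rewrite -subr_ge0.
set T := (X in 0 <= X).
have -> : T = f c - psi c - (f y - psi y) by rewrite /T /psi; field.
by rewrite subr_ge0.
Qed.

(* [exp (2 eps f)] rather than [exp (eps f)], so that [exp t >= (1 + t / 2) ^ 2]
   is a sharp enough lower bound for the exponential. *)
Lemma superjet_expR {R : realType} (eps : R) (f : R -> R) (w : R) : 0 < eps ->
  (forall p A, superjet f w p A -> 0 <= A + eps * p ^+ 2) ->
  forall P B, superjet (fun t => expR (2 * eps * f t)) w P B -> 0 <= B.
Proof.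
move=> eps0 jf P B jz; rewrite leNgt; apply/negP => B0.
set z0 := expR (2 * eps * f w).
have z00 : 0 < z0 by exact: expR_gt0.
pose p := P / z0 / (2 * eps).
(* With this [A], the square [z0 * (1 + x) ^+ 2] below has second-order coefficient [B / 4]. As
   [B < 0], this is strictly above [B / 2], which leaves room for the cubic term, while
   [A + eps * p ^+ 2] stays negative. *)
pose A := - eps * p ^+ 2 + B / z0 / 4 / eps.
have epsn0 : eps != 0 by rewrite gt_eqF.
have z0n0 : z0 != 0 by rewrite gt_eqF.
have AE : eps * (A + eps * p ^+ 2) = B / z0 / 4.
  by rewrite /A; field; rewrite z0n0 epsn0.
have PE : P = z0 * (2 * eps * p) by rewrite /p; field; rewrite z0n0 epsn0.
have Bz : B / z0 < 0 by rewrite pmulr_llt0 ?invr_gt0.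
have : 0 <= eps * (A + eps * p ^+ 2).
  rewrite pmulr_rge0 //; apply: jf.
  have N1 : \forall y \near w,
      B / z0 / 4 < 0 + eps ^+ 2 * p * A * (y - w) + 0 * (y - w) ^+ 2.
    apply: continuous_near_lt; [exact: cvg_cst|exact: continuous_quadratic|].
    by lra.
  have N2 : \forall y \near w,
      0 < 1 + eps * p * (y - w) + eps * A / 2 * (y - w) ^+ 2.
    apply: continuous_near_lt; [exact: cvg_cst|exact: continuous_quadratic|].
    by lra.
  near=> y.
  have Hz : expR (2 * eps * f y) <= z0 + P * (y - w) + B / 2 * (y - w) ^+ 2.
    by near: y.
  have H1 : B / z0 / 4 < 0 + eps ^+ 2 * p * A * (y - w) + 0 * (y - w) ^+ 2.
    by near: y.
  have H2 : 0 < 1 + eps * p * (y - w) + eps * A / 2 * (y - w) ^+ 2 by near: y.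
  set h := y - w in Hz H1 H2 *.
  set x := eps * (p * h + A / 2 * h ^+ 2).
  have H2' : 0 < 1 + x by rewrite /x; lra.
  suff : 2 * eps * f y <= 2 * eps * f w + 2 * x.
    move=> H.
    have : 2 * eps * f y <= 2 * eps * (f w + p * h + A / 2 * h ^+ 2).
      by apply: le_trans H _; rewrite /x; lra.
    by rewrite ler_pM2l // mulr_gt0.
  rewrite -ler_expR expRD -/z0; apply: le_trans Hz _.
  have E : (1 + x) ^+ 2 <= expR (2 * x).
    rewrite expRM_natl; apply: lerXn2r; rewrite ?nnegrE ?expR_ge0 ?expR_ge1Dx //.
    exact: ltW.
  apply: le_trans (_ : z0 * (1 + x) ^+ 2 <= _); last by rewrite ler_pM2l.
  rewrite -subr_ge0.
  have -> : z0 * (1 + x) ^+ 2 - (z0 + P * h + B / 2 * h ^+ 2) =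
    z0 * (h ^+ 2 * ((eps * (A + eps * p ^+ 2) - B / z0 / 4) +
      (eps ^+ 2 * p * A * h - B / z0 / 4))
     + (eps * A / 2 * h ^+ 2) ^+ 2).
    by rewrite PE /x; field.
  rewrite AE subrr add0r; apply: mulr_ge0; first exact: ltW.
  apply: addr_ge0; last exact: sqr_ge0.
  by apply: mulr_ge0; [exact: sqr_ge0|lra].
by rewrite AE; lra.
Unshelve. all: by end_near. Qed.

(** * Convex functions and superjets: Lipschitz bounds, support lines, one-sided slopes *)

(** Secant slopes of a convex function increase. Inner slopes are compared with secants to
    [w - 2 * d] and [w + 2 * d], at distance at least [d], where [f] lies between 0 and [B]. *)
Lemma three_point_lipschitz {R : realType} (w d B : R) (f : R -> R) : 0 < d ->
  (forall x, 0 <= f x) -> f (w - 2 * d) <= B -> f (w + 2 * d) <= B ->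
  forall x z, x < w - 2 * d -> w + 2 * d < z -> three_point_convex x z f ->
  forall u v, w - d < u -> u < v -> v < w + d ->
  d * `|f v - f u| <= B * (v - u).
Proof.
move=> d0 f0 B1 B2 x z xw wz cf u v wu uv vw.
have fB t : w - d < t -> t < w + d -> f t <= B.
  move=> wt tw.
  have := cf (w - 2 * d) t (w + 2 * d) xw _ _ wz.
  move=> H; have {}H := H ltac:(lra) ltac:(lra).
  have h1 : (w + 2 * d - t) * f (w - 2 * d) <= (w + 2 * d - t) * B.
    by rewrite ler_wpM2l //; lra.
  have h2 : (t - (w - 2 * d)) * f (w + 2 * d) <= (t - (w - 2 * d)) * B.
    by rewrite ler_wpM2l //; lra.
  rewrite -(@ler_pM2l _ (4 * d)); last by lra.
  by lra.
have Bu : f u <= B by apply: fB; lra.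
have Bv : f v <= B by apply: fB; lra.
have H1 := cf u v (w + 2 * d) ltac:(lra) uv ltac:(lra) wz.
have H2 := cf (w - 2 * d) u v xw ltac:(lra) uv ltac:(lra).
have := f0 u; have := f0 v => fv fu.
have F1 : (w + 2 * d - u) * (f v - f u) <= (v - u) * (B - f u).
  apply: le_trans (_ : _ <= (v - u) * (f (w + 2 * d) - f u)) _; first by lra.
  by rewrite ler_wpM2l; lra.
have F2 : (u - (w - 2 * d)) * (f u - f v) <= (v - u) * B.
  apply: le_trans (_ : _ <= (v - u) * (f (w - 2 * d) - f u)) _; first by lra.
  by rewrite ler_wpM2l; lra.
have Bvu : (v - u) * (B - f u) <= B * (v - u).
  by rewrite mulrC ler_wpM2r; lra.
have [fuv|fuv] := leP (f u) (f v).
  rewrite ger0_norm; last by lra.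
  apply: le_trans Bvu; apply: le_trans F1.
  by rewrite ler_wpM2r; lra.
rewrite ltr0_norm; last by lra.
rewrite (mulrC B); apply: le_trans F2.
by rewrite opprB ler_wpM2r; lra.
Qed.

Lemma superjetDsqr {R : realType} (f : R -> R) (w p A k c : R) :
  superjet f w p A ->
  superjet (fun t => f t + k / 2 * (t - c) ^+ 2) w (p + k * (w - c)) (A + k).
Proof.
apply: filterS => y H; rewrite -subr_ge0.
set T := (X in 0 <= X).
have -> : T = f w + p * (y - w) + A / 2 * (y - w) ^+ 2 - f y by rewrite /T; field.
by rewrite subr_ge0.
Qed.

(** An upper first-order bound is enough: were [f v] below the line by [m], convexity would lift [f]
    on the other side of [c] above the line with extra slope at least [m / |v - c|], twice the [d]
    at which the bound is invoked. *)
Lemma support_line {R : realType} (x z c p : R) (f : R -> R) :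
  x < c -> c < z -> three_point_convex x z f ->
  (forall d, 0 < d -> \forall t \near c, f t <= f c + p * (t - c) + d * `|t - c|) ->
  forall v, x < v -> v < z -> f c + p * (v - c) <= f v.
Proof.
move=> xc cz cf tf v xv vz; rewrite leNgt; apply/negP => H.
pose m := f c + p * (v - c) - f v.
have m0 : 0 < m by rewrite /m; lra.
have [vc|cv|vc] := ltrgtP v c; last by rewrite /m vc in m0; lra.
- pose d := m / 2 / (c - v).
  have cv0 : 0 < c - v by lra.
  have d0 : 0 < d by rewrite /d !divr_gt0.
  have dE : d * (c - v) = m / 2 by rewrite /d divfK // gt_eqF.
  have /near_ball[e e0 He] := tf _ d0.
  pose h := Num.min (e / 2) ((z - c) / 2).
  have h0 : 0 < h by rewrite /h lt_min; apply/andP; split; lra.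
  have he : h <= e / 2 by rewrite /h ge_min lexx.
  have hz : h <= (z - c) / 2 by rewrite /h ge_min lexx orbT.
  have := He (c + h); rewrite addrAC subrr add0r gtr0_norm // => /(_ ltac:(lra)) fh.
  have := cf v c (c + h) xv vc ltac:(lra) ltac:(lra) => C3.
  have F : (c - v) * f (c + h) <= (c - v) * (f c + p * h + d * h).
    by rewrite ler_pM2l.
  have : 0 <= h * (d * (c - v) - m).
    by rewrite /m; lra.
  by rewrite dE pmulr_rge0 //; lra.
- pose d := m / 2 / (v - c).
  have cv0 : 0 < v - c by lra.
  have d0 : 0 < d by rewrite /d !divr_gt0.
  have dE : d * (v - c) = m / 2 by rewrite /d divfK // gt_eqF.
  have /near_ball[e e0 He] := tf _ d0.
  pose h := Num.min (e / 2) ((c - x) / 2).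
  have h0 : 0 < h by rewrite /h lt_min; apply/andP; split; lra.
  have he : h <= e / 2 by rewrite /h ge_min lexx.
  have hz : h <= (c - x) / 2 by rewrite /h ge_min lexx orbT.
  have := He (c - h); rewrite addrAC subrr add0r normrN gtr0_norm //.
  move=> /(_ ltac:(lra)) fh.
  have := cf (c - h) c v ltac:(lra) ltac:(lra) cv vz => C3.
  have F : (v - c) * f (c - h) <= (v - c) * (f c + p * - h + d * h).
    by rewrite ler_pM2l.
  have : 0 <= h * (d * (v - c) - m).
    by rewrite /m; lra.
  by rewrite dE pmulr_rge0 //; lra.
Qed.

Lemma near_sqr_le {R : realType} (c k d : R) : 0 < d ->
  \forall t \near c, k * (t - c) ^+ 2 <= d * `|t - c|.
Proof.
move=> d0; have k0 : 0 < `|k| + 1 by rewrite ltr_wpDl.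
apply: (@ball_near _ _ (d / (`|k| + 1))); first by rewrite divr_gt0.
move=> t; rewrite ltr_pdivlMr // => H.
rewrite -(real_normK (num_real (t - c))) expr2 mulrA.
rewrite ler_wpM2r //; apply: le_trans (ltW H); rewrite mulrC ler_wpM2l //.
by apply: le_trans (ler_norm _) _; rewrite lerDl.
Qed.

Lemma superjet_first_order {R : realType} (f : R -> R) (c p A : R) :
  superjet f c p A ->
  forall d, 0 < d -> \forall t \near c, f t <= f c + p * (t - c) + d * `|t - c|.
Proof.
move=> jf d d0; apply: filterS2 jf (near_sqr_le c (A / 2) _ d0) => t H1 H2.
by apply: le_trans H1 _; rewrite lerD2l.
Qed.

Lemma lipschitz_superjet {R : realType} (f : R -> R) (w p A L : R) :
  (\forall t \near w, `|f t - f w| <= L * `|t - w|) -> superjet f w p A ->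
  `|p| <= L.
Proof.
move=> lf jf.
have key d : 0 < d ->
    \forall t \near w, 0 <= L * `|t - w| + p * (t - w) + d * `|t - w|.
  move=> d0; apply: filterS2 lf (superjet_first_order _ _ _ _ jf _ d0) => t.
  by rewrite distrC => H1 H2; have := ler_norm (f w - f t); lra.
suff: - p <= L /\ p <= L by rewrite ler_norml => -[? ?]; lra.
split; apply/ler_addgt0Pr => d /key/near_ball[e e0 He].
- have := He (w + e / 2); rewrite addrAC subrr add0r gtr0_norm; last by lra.
  move=> /(_ ltac:(lra)) H.
  have : 0 <= (e / 2) * (L + p + d) by lra.
  by rewrite pmulr_rge0; lra.
- have := He (w - e / 2); rewrite addrAC subrr add0r normrN gtr0_norm; last by lra.
  move=> /(_ ltac:(lra)) H.
  have : 0 <= (e / 2) * (L - p + d) by lra.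
  by rewrite pmulr_rge0; lra.
Qed.

(** At a prescribed point, such as a convex kink, there may be no superjet, but there is one
    arbitrarily near: subtract a steep parabola centred at [c] and maximise. *)
Lemma superjet_dense {R : realType} (x z c : R) (f : R -> R) (P : R -> Prop) :
  x < c -> c < z -> usc_within `]x, z[ f -> (\forall t \near c, P t) ->
  exists w p A, P w /\ superjet f w p A.
Proof.
move=> xc cz uf NP.
have := near_between _ _ _ xc cz; move/(filterI NP) => /near_ball[e e0 He].
pose d := e / 2; have d0 : 0 < d by rewrite /d; lra.
have dI t : c - d <= t <= c + d -> P t /\ x < t < z.
  by move=> tI; apply: He; rewrite real_ltr_distl ?num_real // /d in tI *; lra.
have ufd : usc_within `[c - d, c + d] f.
  by apply: usc_within_sub uf => t /=; rewrite !in_itv /= => /dI[_ ->].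
have [] := usc_within_max _ _ _ _ ufd; first by lra.
move=> b bI bmax.
(* At both ends the parabola exceeds [f b - f c], with [f b] the maximum, so the ends lose to [c]
   and the new maximum is interior. *)
pose K := (f b - f c + 1) / d ^+ 2.
have KE : K * d ^+ 2 = f b - f c + 1 by rewrite /K divfK // gt_eqF // exprn_gt0.
have ug : usc_within `[c - d, c + d]
    (fun t => f t - (0 + 0 * (t - c) + K * (t - c) ^+ 2)).
  apply: usc_withinD ufd _.
  by apply: continuous_usc => t _; apply: cvgN; exact: continuous_quadratic.
have [] := usc_within_max _ _ _ _ ug; first by lra.
move=> w wI wmax.
have wc := wmax c ltac:(lra).
have nd t : (t - c) ^+ 2 = d ^+ 2 -> f t <= f b -> t <> w.
  move=> td ftb tw; move: wc; rewrite -tw td KE; lra.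
have lw : c - d < w.
  rewrite lt_neqAle; apply/andP; split; last by lra.
  by apply/eqP; apply: nd; [rewrite addrAC subrr add0r sqrrN|apply: bmax; lra].
have rw : w < c + d.
  rewrite lt_neqAle; apply/andP; split; last by lra.
  by apply/eqP => /esym; apply: nd; [rewrite addrAC subrr add0r|apply: bmax; lra].
exists w, (2 * K * (w - c)), (2 * K); split; first by apply: (dI _ _).1; lra.
have := near_between _ _ _ lw rw; apply: filterS => y yI.
have := wmax y ltac:(lra); rewrite -subr_ge0 => H; rewrite -subr_ge0.
by apply: le_trans H _; rewrite le_eqVlt; apply/orP; left; apply/eqP; field.
Qed.

(** [pm] and [pp] are the left and right derivatives, obtained as supremum and infimum of secant
    slopes. One point per side expresses sharpness, since convexity propagates it to all points
    closer to [c]. *)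
Lemma one_sided_slopes {R : realType} (x z c : R) (f : R -> R) :
  x < c -> c < z -> three_point_convex x z f ->
  exists pm pp, [/\ pm <= pp,
    forall t, x < t -> t < c -> f c + pm * (t - c) <= f t,
    forall t, c < t -> t < z -> f c + pp * (t - c) <= f t,
    forall d, 0 < d ->
      exists t, [/\ x < t, t < c & f t < f c + (pm - d) * (t - c)] &
    forall d, 0 < d ->
      exists t, [/\ c < t, t < z & f t < f c + (pp + d) * (t - c)]].
Proof.
move=> xc cz cf.
pose s t := (f t - f c) / (t - c).
have sE t : t != c -> f t = f c + s t * (t - c).
  by move=> tc; rewrite /s divfK ?subr_eq0 // addrC subrK.
pose Sl := [set s t | t in [set t | x < t < c]].
pose Sr := [set s t | t in [set t | c < t < z]].
have lr u v : x < u < c -> c < v < z -> s u <= s v.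
  move=> /andP[xu uc] /andP[cv vz].
  have := cf u c v xu uc cv vz.
  rewrite (sE u) ?lt_eqF // (sE v) ?gt_eqF // => H.
  have : 0 <= ((v - c) * (c - u)) * (s v - s u) by lra.
  by rewrite pmulr_rge0 ?subr_ge0 // mulr_gt0 //; lra.
pose ml := (x + c) / 2; pose mr := (c + z) / 2.
have mlI : x < ml < c by rewrite /ml; lra.
have mrI : c < mr < z by rewrite /mr; lra.
have supl : has_sup Sl.
  split; first by exists (s ml), ml.
  by exists (s mr) => _ [t tI <-]; exact: lr.
have infr : has_inf Sr.
  split; first by exists (s mr), mr.
  by exists (s ml) => _ [t tI <-]; exact: lr.
exists (sup Sl), (inf Sr); split.
- apply: ge_sup; first exact: supl.1.
  move=> _ [u uI <-]; apply: lb_le_inf; first exact: infr.1.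
  by move=> _ [v vI <-]; exact: lr.
- move=> t xt tc; rewrite (sE t) ?lt_eqF // lerD2l ler_wnM2r //; first by lra.
  by apply: ub_le_sup; [exact: supl.2|exists t => //=; rewrite xt].
- move=> t ct tz; rewrite (sE t) ?gt_eqF // lerD2l ler_wpM2r //; first by lra.
  by apply: ge_inf; [exact: infr.2|exists t => //=; rewrite ct].
- move=> d d0; have [_ [t /andP[xt tc] <-] H] := sup_adherent d0 supl.
  exists t; split => //; rewrite (sE t) ?lt_eqF // ltrD2l ltr_nM2r //; lra.
- move=> d d0; have [_ [t /andP[ct tz] <-] H] := inf_adherent d0 infr.
  exists t; split => //; rewrite (sE t) ?gt_eqF // ltrD2l ltr_pM2r //; lra.
Qed.

(** The convex function [exp (2 eps f)] is locally Lipschitz, and [0 <= f] keeps it at least 1,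
    where the logarithm is 1-Lipschitz. *)
Lemma subsolution_lipschitz {R : realType} (eps a e : R) (f : R -> R) :
  0 < eps -> usc_within `]a, e[ f ->
  (forall w, a < w < e -> 0 <= f w) ->
  (forall w p A, a < w < e -> superjet f w p A -> 0 <= A + eps * p ^+ 2) ->
  forall c, a < c < e -> exists d L, [/\ 0 < d, a < c - d, c + d < e &
    forall u v, c - d < u < c + d -> c - d < v < c + d ->
    `|f v - f u| <= L * `|v - u|].
Proof.
move=> eps0 uf f0 jf c /andP[ac ce].
have K0 : 0 < 2 * eps by lra.
pose z t := expR (2 * eps * f t).
have z3 : three_point_convex a e z.
  apply: three_point_of_superjets; first exact: usc_within_expR.
  move=> w p A wI; apply: superjet_expR => // p' A'; exact: jf.
pose d := Num.min (c - a) (e - c) / 3.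
have [da de] : 3 * d <= c - a /\ 3 * d <= e - c.
  by rewrite /d mulrC divfK //; split; rewrite ge_min lexx // orbT.
have d0 : 0 < d by rewrite /d divr_gt0 // lt_min; apply/andP; split; lra.
pose B := Num.max (z (c - 2 * d)) (z (c + 2 * d)).
have lz u v : c - d < u -> u < v -> v < c + d -> d * `|z v - z u| <= B * (v - u).
  apply: (@three_point_lipschitz _ _ _ _ _ d0 _ _ _ a e) => //; try lra.
  - by move=> t; exact: expR_ge0.
  - by rewrite /B le_max lexx.
  - by rewrite /B le_max lexx orbT.
have {}lz u v : c - d < u < c + d -> c - d < v < c + d ->
    d * `|z v - z u| <= B * `|v - u|.
  move=> /andP[cu uc] /andP[cv vc]; have [uv|vu|->] := ltgtP u v.
  - by rewrite [`|v - u|]gtr0_norm ?subr_gt0 //; exact: lz.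
  - rewrite (distrC (z v)) (distrC v) [`|u - v|]gtr0_norm ?subr_gt0 //.
    exact: lz.
  - by rewrite !subrr !normr0 !mulr0.
have fz u v : a < u < e -> 2 * eps * (f v - f u) <= `|z v - z u|.
  move=> uI.
  have zu1 : 1 <= z u.
    by apply: le_trans (expR_ge1Dx _); rewrite lerDl mulr_ge0 ?f0 // ltW.
  have zv : z v = z u * expR (2 * eps * (f v - f u)).
    by rewrite /z -expRD; congr expR; ring.
  have := expR_ge1Dx (2 * eps * (f v - f u)) => H.
  have [fuv|] := leP 0 (2 * eps * (f v - f u)); last first.
    by move=> h; apply: le_trans (ltW h) _.
  apply: le_trans (ler_norm _).
  have : 0 <= (z u - 1) * (2 * eps * (f v - f u)) by rewrite mulr_ge0 ?subr_ge0.
  have : z u * (1 + 2 * eps * (f v - f u)) <= z v.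
    by rewrite zv ler_wpM2l //; lra.
  by lra.
exists d, (B / d / (2 * eps)); split; try lra.
move=> u v uI vI.
rewrite mulrAC ler_pdivlMr // mulrAC ler_pdivlMr // [X in X <= _]mulrC.
apply: le_trans (lz _ _ uI vI); rewrite ler_pM2l // mulrC.
have [_|_] := ler0P (f v - f u); last by apply: fz; lra.
by rewrite opprB distrC; apply: fz; lra.
Qed.

(** * The quadratic in the control *)

(** The expression under the infimum in [hjbF]; bounds on the infimum become real inequalities in
    [q]. *)
Definition hjbQ {R : realType} (r mu sigma c eps w p A q : R) : R :=
  2^-1 * sigma ^+ 2 * (eps * p ^+ 2 + A) * q ^+ 2
  + (mu - r) * p * q + (r * w - c) * p.

Lemma quadratic_bounded_below {R : realType} (A B C k : R) :
  (forall q, k <= A * q ^+ 2 + B * q + C) -> 0 <= A.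
Proof.
move=> H; rewrite leNgt; apply/negP => A0.
pose g := `|B| + `|C - k| + 1.
have g1 : 1 <= g by rewrite /g lerDr addr_ge0.
(* Then [A * q = A - g], so [A * q ^+ 2] outweighs the linear and constant terms. *)
pose q := g / - A + 1.
have q1 : 1 <= q by rewrite /q lerDr divr_ge0 //; lra.
have Aq : A * q = - g + A by rewrite /q; field; rewrite lt_eqF.
have := H q; rewrite expr2 mulrA Aq.
have : B * q <= `|B| * q by rewrite ler_wpM2r ?ler_norm //; lra.
have : C - k <= `|C - k| * q.
  by apply: le_trans (ler_norm _) _; rewrite ler_peMr.
have : A * q < 0 by rewrite nmulr_rlt0 //; lra.
have : (- g + A) * q = - (`|B| * q + `|C - k| * q + q) + A * q.
  by rewrite /g; ring.
by lra.
Qed.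

Lemma hjbQ_elliptic {R : realType} (r mu sigma c eps w p k A : R) : 0 < sigma ->
  (forall q, k <= hjbQ r mu sigma c eps w p A q) -> 0 <= A + eps * p ^+ 2.
Proof.
move=> s0 /quadratic_bounded_below.
by rewrite pmulr_rge0 1?addrC // mulr_gt0 ?invr_gt0 // exprn_gt0.
Qed.

(* The discriminant condition [((mu - r) p)^2 = 4 a D] makes
   [hjbQ - k] the square [D (1 + (mu - r) p q / (2 D))^2]. *)
Lemma hjbQ_level {R : realType} (r mu sigma c eps w p k : R) :
  mu != r -> 0 < sigma -> k < (r * w - c) * p ->
  exists A, (forall q, k <= hjbQ r mu sigma c eps w p A q) /\
    (p != 0 -> exists q, hjbQ r mu sigma c eps w p A q = k).
Proof.
move=> mur s0 kp; pose D := (r * w - c) * p - k.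
have D0 : 0 < D by rewrite /D; lra.
have Dn : D != 0 by rewrite gt_eqF.
have sn : sigma != 0 by rewrite gt_eqF.
pose A := ((mu - r) * p) ^+ 2 / (2 * sigma ^+ 2 * D) - eps * p ^+ 2.
have QE q : hjbQ r mu sigma c eps w p A q =
    k + D * (1 + (mu - r) * p * q / (2 * D)) ^+ 2.
  rewrite /hjbQ /A; have -> : (r * w - c) * p = D + k by rewrite /D subrK.
  by field; rewrite Dn sn.
exists A; split=> [q|p0]; first by rewrite QE lerDl mulr_ge0 ?sqr_ge0 // ltW.
exists (- (2 * D) / ((mu - r) * p)); rewrite QE.
have -> : 1 + (mu - r) * p * (- (2 * D) / ((mu - r) * p)) / (2 * D) = 0.
  by field; rewrite Dn p0 subr_eq0 mur.
by rewrite expr0n mulr0 addr0.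
Qed.

Lemma le_hjbQ {R : realType} (r mu sigma c eps w p q A B : R) : A <= B ->
  hjbQ r mu sigma c eps w p A q <= hjbQ r mu sigma c eps w p B q.
Proof.
move=> AB; rewrite /hjbQ !lerD2r; apply: ler_wpM2r; first exact: sqr_ge0.
by apply: ler_wpM2l; [rewrite mulr_ge0 ?sqr_ge0 ?invr_ge0|rewrite lerD2l].
Qed.

(** Stated at a fixed control, because the infimum over [q] can jump as [(w, p)] varies. *)
Lemma continuous_hjbQ {R : realType} (r mu sigma c eps A q : R) :
  continuous (fun wp : R * R => hjbQ r mu sigma c eps wp.1 wp.2 A q).
Proof.
move=> wp.
have c1 : (fun x : R * R => x.1) @ wp --> wp.1 by exact: cvg_fst.
have c2 : (fun x : R * R => x.2) @ wp --> wp.2 by exact: cvg_snd.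
rewrite /hjbQ; apply: cvgD; first apply: cvgD.
- apply: cvgM; [apply: cvgM; [exact: cvg_cst|]|exact: cvg_cst].
  apply: cvgD; [|exact: cvg_cst]; apply: cvgM; [exact: cvg_cst|].
  by rewrite expr2; apply: cvgM.
- apply: cvgM; [|exact: cvg_cst]; apply: cvgM => //; exact: cvg_cst.
- apply: cvgM => //; apply: cvgB; [|exact: cvg_cst].
  by apply: cvgM => //; exact: cvg_cst.
Qed.

(** * A parabola below a subsolution *)

(** Between [c] and one nearly tangent point on either side, a convex function lies below the
    chord. *)
Lemma first_order_no_kink {R : realType} (x z c p : R) (f : R -> R) :
  three_point_convex x z f ->
  (forall d, 0 < d ->
    exists t, [/\ x < t, t < c & f t < f c + (p - d) * (t - c)]) ->
  (forall d, 0 < d ->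
    exists t, [/\ c < t, t < z & f t < f c + (p + d) * (t - c)]) ->
  forall d, 0 < d -> \forall t \near c, f t <= f c + p * (t - c) + d * `|t - c|.
Proof.
move=> cf Hl Hr d d0.
have [u [xu uc fu]] := Hl _ d0; have [v [cv vz fv]] := Hr _ d0.
have := near_between _ _ _ uc cv; apply: filterS => t /andP[ut tv].
have [tc|ct|->] := ltgtP t c; last by rewrite !subrr normr0 !mulr0 !addr0.
- rewrite ltr0_norm; last by lra.
  have C3 := cf u t c xu ut tc ltac:(lra).
  have F : (c - t) * f u <= (c - t) * (f c + (p - d) * (u - c)).
    by rewrite ler_wpM2l //; lra.
  rewrite -(@ler_pM2l _ (c - u)) ?subr_gt0 //.
  by lra.
- rewrite gtr0_norm; last by lra.
  have C3 := cf c t v ltac:(lra) ct tv vz.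
  have F : (t - c) * f v <= (t - c) * (f c + (p + d) * (v - c)).
    by rewrite ler_wpM2l //; lra.
  rewrite -(@ler_pM2l _ (v - c)) ?subr_gt0 //.
  by lra.
Qed.

(* [f] is semiconvex near [w0].  If it has a kink there, any slope strictly
   inside the kink works.  If not, nearby superjets have slopes close to
   [f' w0], so the subsolution inequality bounds their second-order part from
   below by the [A] for which [inf_q hjbQ = k] at [w0]; hence
   [f - A / 2 (t - w0)^2] is convex near [w0]. *)
Lemma subsolution_subjet {R : realType} (r mu sigma c lam eps a e : R)
    (f : R -> R) (w0 k : R) :
  mu != r -> 0 < sigma -> 0 < eps ->
  (forall w, a < w < e -> r * w - c < 0) ->
  usc_within `]a, e[ f -> (forall w, a < w < e -> 0 <= f w) ->
  (forall w p A q, a < w < e -> superjet f w p A ->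
    lam * f w <= hjbQ r mu sigma c eps w p A q) ->
  a < w0 < e -> 0 <= k -> k < lam * f w0 ->
  exists p A, (forall q, k <= hjbQ r mu sigma c eps w0 p A q) /\
    \forall w \near w0, f w0 + p * (w - w0) + A / 2 * (w - w0) ^+ 2 <= f w.
Proof.
move=> mur s0 eps0 rc uf f0 sub w0I k0 kf.
have jf w p A : a < w < e -> superjet f w p A -> 0 <= A + eps * p ^+ 2.
  move=> wI j; apply: (@hjbQ_elliptic _ r mu sigma c eps w p (lam * f w)) => //.
  by move=> q; exact: sub.
have [d [L [d0 ad de lf]]] := subsolution_lipschitz _ _ _ _ eps0 uf f0 jf _ w0I.
have inI w : w0 - d < w < w0 + d -> a < w < e by lra.
have cfw : {for w0, continuous f}.
  apply/(@cvgrPdist_lt _ R^o) => h h0.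
  have L0 : 0 < `|L| + 1 by rewrite ltr_wpDl.
  apply: (@ball_near _ _ (Num.min d (h / (`|L| + 1)))).
    by rewrite lt_min d0 divr_gt0.
  move=> y; rewrite lt_min => /andP[yd yh].
  have yI : w0 - d < y < w0 + d by move: yd; rewrite ltr_norml; lra.
  rewrite distrC; apply: le_lt_trans (lf w0 y ltac:(lra) yI) _.
  rewrite ltr_pdivlMr // mulrC in yh; apply: le_lt_trans yh.
  by rewrite ler_wpM2r //; apply: le_trans (ler_norm _) _; rewrite lerDl.
(* Superjet slopes are at most [L] in size, so [0 <= A + eps * p ^+ 2] gives [- C <= A], and adding
   [C / 2 * (t - w0) ^+ 2] makes [f] convex. *)
pose C := eps * L ^+ 2.
pose y t := f t + C / 2 * (t - w0) ^+ 2.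
have slopeL w p A : w0 - d < w < w0 + d -> superjet f w p A -> `|p| <= L.
  move=> wI; apply: lipschitz_superjet; have /andP[w1 w2] := wI.
  by have := near_between _ _ _ w1 w2; apply: filterS => t; exact: lf.
have uy : usc_within `]w0 - d, w0 + d[ y.
  apply: usc_withinD.
    by apply: usc_within_sub uf => t /=; rewrite !in_itv /=; exact: inI.
  apply: continuous_usc => t _.
  have := @continuous_quadratic _ 0 0 (C / 2) w0 t.
  by under eq_fun do rewrite mul0r !add0r.
have y3 : three_point_convex (w0 - d) (w0 + d) y.
  apply: three_point_of_superjets => // w p A wI jy.
  have := superjetDsqr _ _ _ _ (- C) w0 jy.
  rewrite (_ : (fun t => _) = f); last first.
    by apply/funext => t; rewrite /y; field.
  move=> j; have := jf _ _ _ (inI _ wI) j; have := slopeL _ _ _ wI j.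
  set p' := (p + _) => pL.
  have : p' ^+ 2 <= L ^+ 2.
    rewrite -(real_normK (num_real p')) lerXn2r ?nnegrE //.
    exact: le_trans pL.
  by rewrite -(ler_pM2l eps0) /C; lra.
have wl : w0 - d < w0 by lra.
have wr : w0 < w0 + d by lra.
have [pm [pp [pmp sl sr Hl Hr]]] := one_sided_slopes _ _ _ _ wl wr y3.
have yw0 : y w0 = f w0 by rewrite /y subrr expr0n mulr0 addr0.
have cy : {for w0, continuous y}.
  apply: cvgD => //.
  have := @continuous_quadratic _ 0 0 (C / 2) w0 w0.
  by under eq_fun do rewrite mul0r !add0r.
have supp w p A : w0 - d < w < w0 + d -> superjet f w p A ->
    forall v, w0 - d < v < w0 + d ->
    y w + (p + C * (w - w0)) * (v - w) <= y v.
  move=> /andP[w1 w2] j v /andP[v1 v2].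
  apply: (support_line _ _ _ _ _ w1 w2 y3 _ _ v1 v2).
  exact: superjet_first_order (superjetDsqr _ _ _ _ C w0 j).
(* Semicontinuity of the subdifferential of [y]: support lines at [w] are tested at fixed points [u]
   and [v] whose secants to [w0] have slopes within [h] of [pm] and [pp]. *)
have near_slope h : 0 < h -> \forall w \near w0, forall p A,
    superjet f w p A -> pm - h < p /\ p < pp + h.
  move=> h0.
  have [u [u1 u2 fu]] := Hl _ h0; have [v [v1 v2 fv]] := Hr _ h0.
  have clin m t : {for w0,
      continuous (fun w => y w + (m + C * (w - w0)) * (t - w))}.
    have -> : (fun w => y w + (m + C * (w - w0)) * (t - w)) =
        (fun w => y w + (m * (t - w0) + (C * (t - w0) - m) * (w - w0)
          + (- C) * (w - w0) ^+ 2)).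
      by apply/funext => w; ring.
    by apply: cvgD => //; exact: continuous_quadratic.
  have N1 : \forall w \near w0, y u < y w + (pm - h + C * (w - w0)) * (u - w).
    apply: continuous_near_lt; [exact: cvg_cst|exact: clin|].
    by rewrite subrr mulr0 addr0.
  have N2 : \forall w \near w0, y v < y w + (pp + h + C * (w - w0)) * (v - w).
    apply: continuous_near_lt; [exact: cvg_cst|exact: clin|].
    by rewrite subrr mulr0 addr0.
  have N3 := near_between _ _ _ u2 v1.
  apply: filterS3 N1 N2 N3 => w H1 H2 /andP[uw wv] p A j.
  have wI : w0 - d < w < w0 + d by lra.
  have S1 := supp _ _ _ wI j u ltac:(lra).
  have S2 := supp _ _ _ wI j v ltac:(lra).
  split.
  - have : 0 < (p - (pm - h)) * (w - u) by lra.
    by rewrite pmulr_lgt0; lra.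
  - have : 0 < ((pp + h) - p) * (v - w) by lra.
    by rewrite pmulr_lgt0; lra.
have rc0 : r * w0 - c < 0 by exact: rc.
have /andP[aw0 w0e] := w0I.
(* The control [q = 0] removes the second-order term. At nearby superjets [p > pm - h], and
   [r * w - c < 0] turns this into an upper bound on the drift. *)
have drift : lam * f w0 <= (r * w0 - c) * pm.
  rewrite leNgt; apply/negP => H.
  pose h := (lam * f w0 - (r * w0 - c) * pm) / 2 / (c - r * w0).
  have h0 : 0 < h by rewrite /h !divr_gt0 //; lra.
  have hE : h * (c - r * w0) = (lam * f w0 - (r * w0 - c) * pm) / 2.
    by rewrite /h divfK // gt_eqF //; lra.
  have N : \forall w \near w0, (r * w - c) * (pm - h) < lam * f w.
    apply: continuous_near_lt; last by lra.
      apply: cvgM; last exact: cvg_cst.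
      apply: cvgB; last exact: cvg_cst.
      by apply: cvgM; [exact: cvg_cst|exact: cvg_id].
    by apply: cvgM => //; exact: cvg_cst.
  have := superjet_dense _ _ _ _ _ aw0 w0e uf
    (filterI (near_between _ _ _ aw0 w0e) (filterI N (near_slope _ h0))).
  move=> [w [p [A [[wI [Nw /(_ p A) Sw]] j]]]].
  have [pmh _] := Sw j.
  have := sub _ _ _ 0 wI j; rewrite /hjbQ expr0n !mulr0 !add0r.
  have : (r * w - c) * p <= (r * w - c) * (pm - h).
    by rewrite ler_wnM2l ?ltW // rc.
  by lra.
have kpm : k < (r * w0 - c) * pm by exact: lt_le_trans drift.
have [kink|] := ltP pm pp.
  (* The slope [pm + h] lies strictly inside the kink and keeps the drift above [k]; the linear gaps
     on both sides absorb any quadratic term near [w0]. *)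
  pose h := Num.min ((pp - pm) / 2)
    (((r * w0 - c) * pm - k) / 2 / (c - r * w0)).
  have h0 : 0 < h by rewrite /h lt_min !divr_gt0 //; lra.
  have h1 : h <= (pp - pm) / 2 by rewrite /h ge_min lexx.
  have h2 : h * (c - r * w0) <= ((r * w0 - c) * pm - k) / 2.
    by rewrite -ler_pdivlMr ?ge_min ?lexx ?orbT //; lra.
  have [A [QA _]] :=
    @hjbQ_level _ r mu sigma c eps w0 (pm + h) k mur s0 ltac:(lra).
  exists (pm + h), A; split => //.
  have g0 : 0 < pp - (pm + h) by lra.
  have N1 := near_sqr_le w0 ((A + C) / 2) _ h0.
  have N2 := near_sqr_le w0 ((A + C) / 2) _ g0.
  have N3 := near_between _ _ _ wl wr.
  apply: filterS3 N1 N2 N3 => w H1 H2 /andP[w1 w2].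
  have [ww|ww|->] := ltgtP w w0; last by rewrite !subrr expr0n !mulr0 !addr0.
  - rewrite ltr0_norm ?subr_lt0 // in H1.
    by have := sl w w1 ww; rewrite yw0 /y; lra.
  - rewrite gtr0_norm ?subr_gt0 // in H2.
    by have := sr w ww w2; rewrite yw0 /y; lra.
move=> ppm; have {}ppm : pp = pm by apply/eqP; rewrite eq_le ppm.
subst pp.
have [A [QA]] := @hjbQ_level _ r mu sigma c eps w0 pm k mur s0 kpm.
(* [0 <= k] excludes a zero slope, so a control attaining the level [k] is available. *)
have pm0 : pm != 0 by apply/eqP => E; move: kpm; rewrite E mulr0; lra.
move=> /(_ pm0)[q0 Qq0]; exists pm, A; split => //.
have N : \forall wp \near (w0, pm),
    hjbQ r mu sigma c eps wp.1 wp.2 A q0 < lam * f wp.1.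
  apply: continuous_near_lt; [exact: continuous_hjbQ| |by rewrite Qq0].
  apply: cvgM; first exact: cvg_cst.
  by apply: (@cvg_comp _ _ _ fst f _ (nbhs w0)); [exact: cvg_fst|exact: cfw].
have [[/= B1 B2] [NB1 /near_ball[h h0 NB2]] NB] := N.
have [g g0 Hg] := near_ball _ _
  (filterI (near_between _ _ _ wl wr) (filterI NB1 (near_slope _ h0))).
pose F t := f t + (- A) / 2 * (t - w0) ^+ 2.
have w0g : w0 - g < w0 by lra.
have w0g' : w0 < w0 + g by lra.
have Hg' w : w0 - g < w < w0 + g -> w0 - d < w < w0 + d.
  by move=> wI; have [|//] := Hg w; rewrite ltr_norml; lra.
(* A superjet of [F] with [A' < 0] would give [f] one with second-order part [A' + A < A], and the
   control [q0] would then violate the subsolution inequality. *)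
have F3 : three_point_convex (w0 - g) (w0 + g) F.
  apply: three_point_of_superjets.
    apply: usc_withinD.
      apply: usc_within_sub uf => t /=; rewrite !in_itv /=.
      by move=> /Hg'/inI.
    apply: continuous_usc => t _.
    have := @continuous_quadratic _ 0 0 (- A / 2) w0 t.
    by under eq_fun do rewrite mul0r !add0r.
  move=> w p A' wI jF.
  have := superjetDsqr _ _ _ _ A w0 jF.
  rewrite (_ : (fun t => _) = f); last first.
    by apply/funext => t; rewrite /F; field.
  set p' := (p + _) => j.
  have [|wd [Bw /(_ _ _ j) pS]] := Hg w; first by rewrite ltr_norml; lra.
  have {pS} Bp : B2 p' by apply: NB2; rewrite ltr_norml; lra.
  have Qw : hjbQ r mu sigma c eps w p' A q0 < lam * f w by exact: (NB (w, p')).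
  have := sub _ _ _ q0 (inI _ (Hg' _ wI)) j => Sw.
  rewrite leNgt; apply/negP => A'0.
  have : hjbQ r mu sigma c eps w p' (A' + A) q0 <=
      hjbQ r mu sigma c eps w p' A q0 by apply: le_hjbQ; lra.
  by lra.
have fo := first_order_no_kink _ _ _ _ _ y3 Hl Hr.
have := near_between _ _ _ w0g w0g'; apply: filterS => w /andP[w1 w2].
have := @support_line _ _ _ _ pm _ w0g w0g' F3 _ w w1 w2.
rewrite /F subrr expr0n mulr0 addr0 => H.
suff : f w0 + pm * (w - w0) <= f w + - A / 2 * (w - w0) ^+ 2 by lra.
(* [F] and [y] differ by a multiple of [(t - w0) ^+ 2], so the first-order bound for [y] at [w0],
   with slope [pm], passes to [F]. *)
apply: H => h' h'0.
have h20 : 0 < h' / 2 by lra.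
apply: filterS2 (fo _ h20) (near_sqr_le w0 (- (A + C) / 2) _ h20) => t.
by rewrite yw0 /y; lra.
Qed.

(** * Comparison of sub- and supersolutions *)

(** The supersolution property enters through arbitrary lower bounds [k] of [hjbQ], so the value
    [+oo] never appears. *)
Lemma viscosity_comparison {R : realType} (r mu sigma c lam eps a e : R)
    (U V : R -> R) :
  mu != r -> 0 < sigma -> 0 < lam -> 0 < eps -> a <= e ->
  (forall w, a < w < e -> r * w - c < 0) ->
  usc_within `[a, e] U -> usc_within `[a, e] (fun x => - V x) ->
  U a <= V a -> U e <= V e ->
  (forall w, a < w < e -> 0 <= U w) -> (forall w, a < w < e -> 0 <= V w) ->
  (forall w p A q, a < w < e -> superjet U w p A ->
    lam * U w <= hjbQ r mu sigma c eps w p A q) ->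
  (forall w p A k, a < w < e -> superjet (fun x => - V x) w (- p) (- A) ->
    (forall q, k <= hjbQ r mu sigma c eps w p A q) -> k <= lam * V w) ->
  forall x, a <= x <= e -> U x <= V x.
Proof.
move=> mur s0 lam0 eps0 ae rc uU uV Ua Ue U0 V0 sub super x xI.
have uUV := usc_withinD _ _ _ uU uV.
have [w wI wmax] := usc_within_max _ _ _ ae uUV.
rewrite leNgt; apply/negP => VU.
have M0 : V w < U w by have := wmax _ xI; lra.
have aw : a < w.
  by rewrite lt_neqAle; apply/andP; split; [apply/eqP => E; subst w|]; lra.
have we : w < e.
  by rewrite lt_neqAle; apply/andP; split; [apply/eqP => E; subst w|]; lra.
have wI' : a < w < e by rewrite aw we.
pose k := (lam * V w + lam * U w) / 2.
have lVU : lam * V w < lam * U w by rewrite ltr_pM2l.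
have lV0 : 0 <= lam * V w by rewrite mulr_ge0 ?V0 // ltW.
have [|||p [A [kQ N]]] := @subsolution_subjet _ r mu sigma c lam eps a e U w k
  mur s0 eps0 rc _ U0 sub wI'.
- by apply: usc_within_sub uU => t /=; rewrite !in_itv /=; lra.
- by rewrite /k; lra.
- by rewrite /k; lra.
have : k <= lam * V w; last by rewrite /k; lra.
apply: super wI' _ kQ.
apply: filterS2 N (near_between _ _ _ aw we) => t H tI.
by have := wmax t ltac:(lra); lra.
Qed.

(** * Semicontinuous envelopes *)

(** A set [V] witnessing that the envelope is below [k] at [x] is also a neighbourhood of every
    nearby point, so it serves there as well. *)
Lemma usc_envelope_usc {R : realType} (D : set R) (u : R -> R) :
  (forall x, D x -> usc_envelope D u x \is a fin_num) ->
  usc_within D (fun x => fine (usc_envelope D u x)).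
Proof.
move=> ufin x Dx k.
rewrite -lte_fin fineK ?ufin // => /ereal_inf_lt[_ [V NV <-] supV].
have NV' : \forall y \near x, D y -> V y by exact: NV.
have : \forall y \near x, nbhs y (fun z => D z -> V z) by exact: nbhs_interior.
apply: filterS => y Vy Dy; rewrite -lte_fin fineK ?ufin //.
by apply: le_lt_trans supV; apply: ereal_inf_lbound; exists V.
Qed.

Lemma le_usc_envelope {R : realType} (D : set R) (u : R -> R) (x : R) : D x ->
  ((u x)%:E <= usc_envelope D u x)%E.
Proof.
move=> Dx; apply: le_ereal_inf_tmp => _ [V NV <-].
apply: ereal_sup_ubound; exists x => //.
have NV' : \forall y \near x, D y -> V y by exact: NV.
exact: nbhs_singleton NV' Dx.
Qed.

Lemma usc_envelope_le {R : realType} (D : set R) (u : R -> R) (x k : R) :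
  (\forall y \near x, D y -> u y <= k) -> (usc_envelope D u x <= k%:E)%E.
Proof.
move=> uk; apply: ge_ereal_inf.
exists (ereal_sup [set (u y)%:E | y in [set y | u y <= k]]).
  by exists [set y | u y <= k].
by apply: ge_ereal_sup => _ [y /= yk <-]; rewrite lee_fin.
Qed.

(** Carries the Dirichlet data over to the envelopes. *)
Lemma usc_envelope_continuous {R : realType} (D : set R) (u : R -> R) (x : R) :
  D x -> continuous_at_within D u x -> usc_envelope D u x = (u x)%:E.
Proof.
move=> Dx cu; apply/eqP; rewrite eq_le le_usc_envelope // andbT.
apply/lee_addgt0Pr => d d0; rewrite -EFinD; apply: usc_envelope_le.
have h : u x < u x + d by rewrite ltrDl.
have : \forall y \near within D (nbhs x), u y < u x + d.
  exact: cvgr_lt cu _ h.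
by rewrite near_withinE; apply: filterS => y H /H/ltW.
Qed.

Lemma lsc_envelopeE {R : realType} (D : set R) (u : R -> R) (x : R) :
  lsc_envelope D u x = (- usc_envelope D (fun y => - u y)%R x)%E.
Proof. by []. Qed.

(** * From test functions to jets *)

(** The test parabola has no constant term: local extrema of [u - phi] do not see it. *)
Lemma is_derive_quadratic {R : realType} (p A w y : R) :
  is_derive y 1 (fun t : R => p * (t - w) + A / 2 * (t - w) ^+ 2)
    (p + A * (y - w)).
Proof.
apply: is_derive_eq.
by rewrite /GRing.scale /=; field.
Qed.

Lemma derive1_quadratic {R : realType} (p A w : R) :
  derive1 (fun t : R => p * (t - w) + A / 2 * (t - w) ^+ 2) =
  fun y => p + A * (y - w).
Proof.
apply/funext => y; rewrite derive1E.
by apply: derive_val; exact: is_derive_quadratic.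
Qed.

Lemma derive1_affine {R : realType} (p A w : R) :
  derive1 (fun t : R => p + A * (t - w)) = fun=> A.
Proof.
apply/funext => y; rewrite derive1E.
apply: derive_val; apply: is_derive_eq.
by rewrite /GRing.scale /=; ring.
Qed.

Lemma derive2_quadratic {R : realType} (p A w : R) :
  derive1n 2 (fun t : R => p * (t - w) + A / 2 * (t - w) ^+ 2) = fun=> A.
Proof. by rewrite /= derive1_quadratic derive1_affine. Qed.

Lemma C2_on_quadratic {R : realType} (a b p A w : R) :
  C2_on a b (fun t : R => p * (t - w) + A / 2 * (t - w) ^+ 2).
Proof.
split=> [y _|y _|y _].
- exact: (@ex_derive _ _ _ _ _ _ _ (is_derive_quadratic p A w y)).
- rewrite derive1_quadratic; exact: ex_derive.
- by rewrite derive2_quadratic; exact: cvg_cst.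
Qed.

Lemma hjbF_le0 {R : realType} (r mu sigma c lam eps w u p A q : R) :
  (hjbF r mu sigma c lam eps w u p A <= 0)%E ->
  lam * u <= hjbQ r mu sigma c eps w p A q.
Proof.
move=> F0; rewrite -subr_le0 -lee_fin; apply: le_trans F0.
rewrite EFinB; apply: leeB => //; apply: ereal_inf_lbound.
by exists q.
Qed.

(** A lower bound [k] of the quadratic bounds the infimum, so [hjbF] is at most [lam * u - k] and
    the infinite case is excluded. *)
Lemma hjbF_ge0 {R : realType} (r mu sigma c lam eps w u p A k : R) :
  (0 <= hjbF r mu sigma c lam eps w u p A)%E ->
  (forall q, k <= hjbQ r mu sigma c eps w p A q) -> k <= lam * u.
Proof.
move=> F0 kQ; rewrite -subr_ge0 -lee_fin; apply: le_trans F0 _.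
rewrite EFinB; apply: leeB => //; apply: le_ereal_inf_tmp => _ [q _ <-].
by rewrite lee_fin; exact: kQ.
Qed.

Lemma subsolution_superjet {R : realType} (r mu sigma c lam eps a e : R)
    (U : R -> R) :
  viscosity_subsolution (hjbF r mu sigma c lam eps) a e U ->
  forall w p A q, a < w < e -> superjet U w p A ->
  lam * U w <= hjbQ r mu sigma c eps w p A q.
Proof.
move=> [_ sub] w p A q wI jU; apply: hjbF_le0.
have := sub _ w (C2_on_quadratic a e p A w).
rewrite in_itv /= wI derive1_quadratic derive1_affine subrr mulr0 addr0.
apply=> //; apply: filterS jU => y /=.
by rewrite subrr expr0n !mulr0 addr0; lra.
Qed.

Lemma supersolution_subjet {R : realType} (r mu sigma c lam eps a e : R)
    (V : R -> R) :
  viscosity_supersolution (hjbF r mu sigma c lam eps) a e V ->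
  forall w p A k, a < w < e -> superjet (fun x => - V x) w (- p) (- A) ->
  (forall q, k <= hjbQ r mu sigma c eps w p A q) -> k <= lam * V w.
Proof.
move=> [_ super] w p A k wI jV; apply: hjbF_ge0.
have := super _ w (C2_on_quadratic a e p A w).
rewrite in_itv /= wI derive1_quadratic derive1_affine subrr mulr0 addr0.
apply=> //; apply: filterS jV => y /=.
by rewrite subrr expr0n !mulr0 addr0; lra.
Qed.

(** * Uniqueness *)

(** The chain is [u <= U <= V <= v], with [U] the upper envelope of [u] and [V] the lower envelope
    of [v]; comparison gives the middle step, and exchanging [u] and [v] then yields equality. *)
Lemma admissible_le {R : realType} (r mu sigma c lam eps a e ua ue : R)
    (u v : R -> R) :
  mu != r -> 0 < sigma -> 0 < lam -> 0 < eps -> a <= e ->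
  (forall w, a < w < e -> r * w - c < 0) ->
  admissible_solution (hjbF r mu sigma c lam eps) a e ua ue u ->
  admissible_solution (hjbF r mu sigma c lam eps) a e ua ue v ->
  forall x, a <= x <= e -> u x <= v x.
Proof.
move=> mur s0 lam0 eps0 ae rc.
move=> [[[finu _ sub _] uaE ueE] [_ u0 cua cue]].
move=> [[[_ finv _ super] vaE veE] [_ v0 cva cve]].
set D := `[a, e]%classic in finu finv sub super cua cue cva cve.
have DE x : D x = (a <= x <= e) by rewrite /D /= in_itv.
have Da : D a by rewrite DE lexx.
have De : D e by rewrite DE lexx ae.
pose U x := fine (usc_envelope D u x).
pose V x := fine (lsc_envelope D v x).
have finu' x : D x -> usc_envelope D u x \is a fin_num by exact: finu.
have finv' x : D x -> usc_envelope D (fun y => - v y) x \is a fin_num.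
  by move=> Dx; rewrite -fin_numN; exact: finv.
have VE x : V x = - fine (usc_envelope D (fun y => - v y) x).
  by rewrite /V lsc_envelopeE fineN.
have leuU x : D x -> u x <= U x.
  by move=> Dx; rewrite -lee_fin /U fineK ?finu'// le_usc_envelope.
have leVv x : D x -> V x <= v x.
  move=> Dx; rewrite VE lerNl -lee_fin fineK ?finv' //.
  exact: (le_usc_envelope D (fun y => - v y)).
have V0 x : D x -> 0 <= V x.
  move=> Dx; rewrite VE oppr_ge0 -lee_fin fineK ?finv' //.
  apply: usc_envelope_le; apply: filterE => y Dy.
  by rewrite oppr_le0; exact: v0.
have Vcont x : D x -> continuous_at_within D v x -> V x = v x.
  move=> Dx cv; rewrite VE usc_envelope_continuous /= ?opprK //.
  exact: cvgN.
move=> x xI; apply: le_trans (leuU x _) _; first by rewrite DE.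
apply: le_trans (leVv x _); last by rewrite DE.
apply: (@viscosity_comparison _ r mu sigma c lam eps a e U V) => //.
- exact: usc_envelope_usc.
- rewrite (_ : (fun x => - V x) =
      (fun x => fine (usc_envelope D (fun y => - v y) x))).
    exact: usc_envelope_usc.
  by apply/funext => t; rewrite VE opprK.
- by rewrite Vcont // /U usc_envelope_continuous //= uaE vaE.
- by rewrite Vcont // /U usc_envelope_continuous //= ueE veE.
- move=> w wI; have Dw : D w by rewrite DE; lra.
  by apply: le_trans (leuU w Dw); exact: u0.
- by move=> w wI; apply: V0; rewrite DE; lra.
- exact: subsolution_superjet.
- exact: supersolution_subjet.
Qed.

Theorem corollary4p1 (R : realType) (r mu sigma c lambda eps b : R)
    (hr : 0 < r) (hmu : r < mu) (hsigma : 0 < sigma) (hc : 0 < c)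
    (hlambda : 0 < lambda) (heps : 0 < eps) (hb : b < c / r)
    (u1 u2 : R -> R)
    (hu1 : admissible_solution (hjbF r mu sigma c lambda eps) b (c / r) 1 0 u1)
    (hu2 : admissible_solution (hjbF r mu sigma c lambda eps) b (c / r) 1 0 u2) :
  {in `[b, c / r], u1 =1 u2}.
Proof.
have mur : mu != r by rewrite gt_eqF.
have rc w : b < w < c / r -> r * w - c < 0.
  by move=> /andP[_]; rewrite ltr_pdivlMr // subr_lt0 mulrC.
move=> x; rewrite in_itv /= => xI; apply/eqP; rewrite eq_le.
have le := admissible_le _ _ _ _ _ _ _ _ _ _ _ _ mur hsigma hlambda heps (ltW hb) rc.
by rewrite (le _ _ _ _ hu1 hu2) // (le _ _ _ _ hu2 hu1).
Qed.
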